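(* The James tree space $JT$ does not have the weak Lebesgue property; that is, there exists a Riemann integrable function $f:[0,1]\to JT$ which is not weakly continuous almost everywhere.
   Context: All Banach spaces are real. A tagged partition of $[0,1]$ is a finite collection $\mathcal P=\{(s_i,[t_{i-1},t_i]):1\le i\le N\}$, where the $[t_{i-1},t_i]$ are non-overlapping closed intervals covering $[0,1]$ and $s_i\in(t_{i-1},t_i)$; its norm is $\max_i(t_i-t_{i-1})$, and for $f:[0,1]\to X$ one puts $f(\mathcal P)=\sum_{i=1}^N (t_i-t_{i-1})f(s_i)$. A function $f:[0,1]\to X$ into a Banach space $X$ is Riemann integrable, with integral $x\in X$, if for every $\varepsilon>0$ there is $\delta>0$ such that $\|f(\mathcal P)-x\|<\varepsilon$ for all tagged partitions $\mathcal P$ of $[0,1]$ with norm less than $\delta$. A Banach space $X$ has the weak Lebesgue property (WLP) if every Riemann integrable $f:[0,1]\to X$ is weakly continuous almost everywhere, i.e. the set of points of $[0,1]$ at which $f$ is not continuous with respect to the weak topology of $X$ has Lebesgue measure zero. James tree space: let $T=\{(n,k): n=0,1,2,\dots,\ k=1,2,\dots,2^n\}$ be the dyadic tree, where the node $(n,k)$ has the two immediate successors $(n+1,2k-1)$ and $(n+1,2k)$. A segment of $T$ is a finite sequence $\{p_1,\dots,p_m\}$ of nodes such that $p_{j+1}$ is an immediate successor of $p_j$ for $j=1,\dots,m-1$. $JT$ is the completion of $c_{00}(T)$ (finitely supported real functions on $T$) under the norm $$\|x\|=\sup\sqrt{\sum_{j=1}^l\Big(\sum_{(n,k)\in S_j}x(n,k)\Big)^2},$$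 where the supremum is over all $l\in\mathbb N$ and all families of pairwise disjoint segments $S_1,\dots,S_l$ of $T$. *)

(* Defs.v *)
From HB Require Import structures.
From mathcomp Require Import all_boot all_order all_algebra ring_quotient.
From mathcomp Require Import all_classical all_reals all_analysis.
From mathcomp Require Import ring lra.

Set Implicit Arguments.
Unset Strict Implicit.
Unset Printing Implicit Defensive.

Import Order.TTheory GRing.Theory Num.Theory.
Import numFieldNormedType.Exports.

Local Open Scope classical_set_scope.
Local Open Scope ring_scope.
Local Open Scope quotient_scope.

Section CauchySequences.
Variables (R : realType) (V : normedModType R).

Definition cauchy_seq_pred : {pred nat -> V} :=
  fun u => `[< cauchy (u @ \oo) >].

Lemma cauchy_seq_predP (u : nat -> V) : reflect (forall e : R, 0 < e ->
    exists N : nat, forall m n, (N <= m)%N -> (N <= n)%N -> `|u m - u n| < e)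
  (u \in cauchy_seq_pred).
Proof.
apply: (iffP idP) => [/asboolP/cauchyP Cu e e0|Cu].
  have e2 : 0 < e / 2 by rewrite divr_gt0.
  have [x [N _ ux]] := Cu _ e2.
  exists N => m n Nm Nn; rewrite [e]splitr -(subrKA x).
  rewrite (le_lt_trans (ler_normD _ _))// ltrD//.
    by have := ux m Nm; rewrite /= -ball_normE/= distrC.
  by have := ux n Nn; rewrite /= -ball_normE/=.
apply/asboolP/cauchyP => e e0; have [N uN] := Cu _ e0.
by exists (u N), N => // n /= Nn; rewrite -ball_normE/=; exact: uN.
Qed.

Fact cauchy_seq_submod_closed : submod_closed cauchy_seq_pred.
Proof.
split=> [|a u v /cauchy_seq_predP Cu /cauchy_seq_predP Cv].
  apply/cauchy_seq_predP => e e0; exists 0%N => m n _ _.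
  by rewrite [X in X - _]/(0 : V) [X in _ - X]/(0 : V) subrr normr0.
apply/cauchy_seq_predP => e e0.
have a1 : 0 < `|a| + 1 by rewrite ltr_pwDr.
have e2 : 0 < e / 2 by rewrite divr_gt0.
have [N1 C1] := Cu (e / 2 / (`|a| + 1)) (divr_gt0 e2 a1).
have [N2 C2] := Cv (e / 2) e2.
exists (maxn N1 N2) => m n; rewrite !geq_max => /andP[m1 m2] /andP[n1 n2].
have -> : (a *: u + v) m - (a *: u + v) n
    = a *: (u m - u n) + (v m - v n).
  by rewrite scalerBr addrACA -opprD.
rewrite (le_lt_trans (ler_normD _ _))// normrZ [e]splitr ler_ltD//; last first.
  exact: C2.
have := C1 _ _ m1 n1; rewrite ltr_pdivlMr// => /ltW; apply: le_trans.
by rewrite mulrC ler_wpM2l// lerDl.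
Qed.

HB.instance Definition _ := GRing.isSubmodClosed.Build R (nat -> V)
  cauchy_seq_pred cauchy_seq_submod_closed.

Record cauchy_sequence := CauchySequence {
  cauchy_sequence_val :> nat -> V ;
  _ : cauchy_sequence_val \in cauchy_seq_pred }.

HB.instance Definition _ := [isSub for cauchy_sequence_val].
HB.instance Definition _ := [Choice of cauchy_sequence by <:].
HB.instance Definition _ := [SubChoice_isSubLmodule of cauchy_sequence by <:].

Lemma cauchy_sequenceP (u : cauchy_sequence) (e : R) : 0 < e ->
  exists N : nat, forall m n, (N <= m)%N -> (N <= n)%N -> `|u m - u n| < e.
Proof. by case: u => u /= /cauchy_seq_predP; exact. Qed.

Lemma cauchy_sequenceDE (u v : cauchy_sequence) n : (u + v) n = u n + v n.
Proof. by []. Qed.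

Lemma cauchy_sequenceBE (u v : cauchy_sequence) n : (u - v) n = u n - v n.
Proof. by []. Qed.

Lemma cauchy_sequenceZE (a : R) (u : cauchy_sequence) n : (a *: u) n = a *: u n.
Proof. by []. Qed.

Definition null_seq_pred : {pred cauchy_sequence} :=
  fun u => `[< (u : nat -> V) @ \oo --> (0 : V) >].

Lemma null_seqP (u : cauchy_sequence) :
  reflect ((u : nat -> V) @ \oo --> (0 : V)) (u \in null_seq_pred).
Proof. by apply: (iffP idP) => [/asboolP|?]; last apply/asboolP. Qed.

Fact null_seq_zmod_closed : zmod_closed null_seq_pred.
Proof.
split=> [|u v /null_seqP u0 /null_seqP v0]; apply/null_seqP.
  by rewrite (_ : cauchy_sequence_val 0 = cst 0)//; exact: cvg_cst.
rewrite -(subr0 (0 : V)); exact: cvgB.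
Qed.

HB.instance Definition _ := GRing.isZmodClosed.Build cauchy_sequence
  null_seq_pred null_seq_zmod_closed.

Lemma null_seqZ (a : R) (u : cauchy_sequence) :
  u \in null_seq_pred -> a *: u \in null_seq_pred.
Proof.
move=> /null_seqP u0; apply/null_seqP.
rewrite -(scaler0 _ a); exact: cvgZl_tmp.
Qed.

Lemma cauchy_sequence_norm_cvg (u : cauchy_sequence) :
  cvg (`|u n| @[n --> \oo]).
Proof.
apply/cauchy_cvgP/cauchyP => e e0; have [N uN] := cauchy_sequenceP u e0.
exists `|u N|, N => // n /= Nn; rewrite -ball_normE/=.
by rewrite (le_lt_trans (ler_dist_dist _ _))// uN.
Qed.

End CauchySequences.

Section Completion.
Variables (R : realType) (V : normedModType R).

(** Cauchy sequences modulo null sequences; the norm of a class is the limit of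
    the norms of any of its representatives. *)
Definition completion : Type := {ideal_quot @null_seq_pred R V}.

HB.instance Definition _ := GRing.Zmodule.on completion.
HB.instance Definition _ := EqQuotient.on completion.

Implicit Types (x y : completion) (u v : cauchy_sequence V) (a b : R).

Lemma completion_piP u v :
  \pi_completion u = \pi_completion v <-> u - v \in @null_seq_pred R V.
Proof. by split=> [/eqP|?]; [|apply/eqP]; rewrite -Quotient.idealrBE. Qed.

Lemma completion_ind (P : completion -> Prop) :
  (forall u, P (\pi_completion u)) -> forall x, P x.
Proof. by move=> Ppi x; rewrite -(reprK x). Qed.

Lemma completion_piD u v :
  \pi_completion (u + v) = \pi_completion u + \pi_completion v.
Proof. exact: Quotient.pi_add. Qed.

Lemma completion_piB u v :
  \pi_completion (u - v) = \pi_completion u - \pi_completion v.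
Proof. by rewrite completion_piD; congr (_ + _); exact: Quotient.pi_opp. Qed.

Lemma completion_pi0 : \pi_completion 0 = 0.
Proof. by rewrite -(subrr 0) completion_piB subrr. Qed.

Definition completion_scale a x : completion :=
  \pi_completion (a *: repr x).

Lemma completion_scale_pi a u :
  completion_scale a (\pi_completion u) = \pi_completion (a *: u).
Proof.
apply/completion_piP; rewrite -scalerBr; apply: null_seqZ.
by apply/completion_piP; rewrite reprK.
Qed.

Fact completion_scaleA a b x :
  completion_scale a (completion_scale b x) = completion_scale (a * b) x.
Proof.
by elim/completion_ind: x => u; rewrite !completion_scale_pi scalerA.
Qed.

Fact completion_scale1 : left_id 1 completion_scale.
Proof. by elim/completion_ind => u; rewrite completion_scale_pi scale1r. Qed.

Fact completion_scaleDr : right_distributive completion_scale +%R.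
Proof.
move=> a; elim/completion_ind => u; elim/completion_ind => v.
by rewrite -completion_piD !completion_scale_pi -completion_piD scalerDr.
Qed.

Fact completion_scaleDl x : {morph completion_scale^~ x : a b / a + b}.
Proof.
elim/completion_ind: x => u a b.
by rewrite !completion_scale_pi -completion_piD scalerDl.
Qed.

HB.instance Definition _ := GRing.Zmodule_isLmodule.Build R completion
  completion_scaleA completion_scale1 completion_scaleDr completion_scaleDl.

Definition completion_norm x : R := lim (`|repr x n| @[n --> \oo]).

Lemma completion_norm_cvg u :
  `|u n| @[n --> \oo] --> completion_norm (\pi_completion u).
Proof.
set w : cauchy_sequence V := repr (\pi_completion u).
have wl : `|w n| @[n --> \oo] --> completion_norm (\pi_completion u).
  exact: cauchy_sequence_norm_cvg.
have /null_seqP uw0 : w - u \in @null_seq_pred R V.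
  by apply/completion_piP; rewrite reprK.
apply/cvgrPdist_lt => e e0; have e2 : 0 < e / 2 by rewrite divr_gt0.
move/cvgrPdist_lt/(_ _ e2) : wl => wl.
move/cvgrPdist_lt/(_ _ e2) : uw0 => uw0.
near=> n; rewrite -(subrKA `|w n|) [e]splitr.
rewrite (le_lt_trans (ler_normD _ _))// ltrD//; first by near: n.
rewrite (le_lt_trans (ler_dist_dist _ _))// -normrN -sub0r.
by near: n.
Unshelve. all: by end_near. Qed.

Lemma completion_norm_le u e N : (forall n, (N <= n)%N -> `|u n| <= e) ->
  completion_norm (\pi_completion u) <= e.
Proof.
move=> ue; apply: (ler_cvg_to (completion_norm_cvg (u := u)) (cvg_cst e)).
by exists N.
Qed.

Fact completion_ler_normD x y :
  completion_norm (x + y) <= completion_norm x + completion_norm y.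
Proof.
elim/completion_ind: x => u; elim/completion_ind: y => v; rewrite -completion_piD.
apply: (ler_cvg_to (completion_norm_cvg (u := u + v))
  (cvgD (completion_norm_cvg (u := u)) (completion_norm_cvg (u := v)))).
by apply: nearW => n; exact: ler_normD.
Qed.

Fact completion_normZ a x :
  completion_norm (a *: x) = `|a| * completion_norm x.
Proof.
elim/completion_ind: x => u.
have -> : a *: \pi_completion u = \pi_completion (a *: u).
  exact: completion_scale_pi.
apply: (cvg_unique _ (completion_norm_cvg (u := a *: u))) => //.
rewrite (_ : (fun n => _) = fun n => `|a| * `|u n|); last first.
  by apply/funext => n; rewrite -normrZ.
by apply: cvgMl_tmp; exact: completion_norm_cvg.
Qed.

Fact completion_norm0_eq0 x : completion_norm x = 0 -> x = 0.
Proof.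
elim/completion_ind: x => u u0; rewrite -completion_pi0; apply/completion_piP.
rewrite subr0; apply/null_seqP/norm_cvg0P; rewrite -u0.
exact: completion_norm_cvg.
Qed.

HB.instance Definition _ := Lmodule_isNormed.Build R completion
  completion_ler_normD completion_normZ completion_norm0_eq0.

Lemma completion_normE u :
  `|u n| @[n --> \oo] --> `|\pi_completion u : completion|.
Proof. exact: completion_norm_cvg. Qed.

Fact cst_cauchy (v : V) : cst v \in @cauchy_seq_pred R V.
Proof.
by apply/cauchy_seq_predP => e e0; exists 0%N => m n _ _; rewrite subrr normr0.
Qed.

(** The canonical embedding is linear, isometric, and has dense range. *)
Definition completion_embed (v : V) : completion :=
  \pi_completion (CauchySequence (cst_cauchy v)).

Fact completion_embed_linear : linear completion_embed.
Proof.
move=> a v w.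
have -> : a *: completion_embed v =
    \pi_completion (a *: CauchySequence (cst_cauchy v)).
  exact: completion_scale_pi.
by rewrite -completion_piD; congr (\pi_completion _); exact/val_inj.
Qed.

HB.instance Definition _ := GRing.isLinear.Build R V completion *:%R
  completion_embed completion_embed_linear.

Lemma completion_embed_norm (v : V) : `|completion_embed v| = `|v|.
Proof.
have vE := completion_normE (u := CauchySequence (cst_cauchy v)).
apply: (cvg_unique _ vE) => //; move=> /=.
exact: cvg_cst.
Qed.

Lemma completion_embed_approx x e : 0 < e ->
  exists v : V, `|x - completion_embed v| < e.
Proof.
elim/completion_ind: x => u e0; have e2 : 0 < e / 2 by rewrite divr_gt0.
have [N uN] := cauchy_sequenceP u e2.
exists (u N); rewrite -completion_piB (@le_lt_trans _ _ (e / 2))//; last first.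
  by rewrite ltr_pdivrMr// ltr_pMr// ltr1n.
apply: (@completion_norm_le _ _ N) => n Nn; apply/ltW.
by rewrite cauchy_sequenceBE; exact: uN.
Qed.

Lemma completion_embed_dense : dense (range completion_embed).
Proof.
move=> O [x Ox] oO; have /nbhs_ballP[e /= e0 xeO] : nbhs x O.
  exact: open_nbhs_nbhs.
have [v xv] := completion_embed_approx x e0.
exists (completion_embed v); split; last by exists v.
by apply: xeO; rewrite -ball_normE.
Qed.

Fact completion_complete (F : set_system completion) :
  ProperFilter F -> cauchy F -> cvg F.
Proof.
move=> FF /cauchyP Fc.
have Fv n : exists v : V, F (ball (completion_embed v) n.+1%:R^-1).
  have n0 : 0 < n.+1%:R^-1 / 2 :> R by rewrite divr_gt0.
  have [x Fx] := Fc _ n0.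
  have [v xv] := completion_embed_approx x n0.
  exists v; apply: filterS Fx => y.
  rewrite -!ball_normE/= => xy.
  rewrite -(subrKA x) (le_lt_trans (ler_normD _ _))//.
  by rewrite [ltRHS]splitr ltrD// distrC.
have [v {}Fv] := choice Fv.
have vB m n : `|v m - v n| < m.+1%:R^-1 + n.+1%:R^-1.
  have [y] := filter_ex (filterI (Fv m) (Fv n)).
  rewrite -!ball_normE/= => -[my ny].
  rewrite -completion_embed_norm raddfB -(subrKA y).
  by rewrite (le_lt_trans (ler_normD _ _))// ltrD// distrC.
have small (e : R) : 0 < e -> exists N : nat, forall n, (N <= n)%N ->
    n.+1%:R^-1 < e.
  move=> e0; exists (Num.truncn e^-1) => n Nn.
  rewrite invf_plt ?posrE//.
  rewrite (lt_le_trans (truncnS_gt _))// ler_nat.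
  by rewrite ltnS.
have Cv : v \in @cauchy_seq_pred R V.
  apply/cauchy_seq_predP => e e0.
  have [|N sN] := small (e / 2); first by rewrite divr_gt0.
  exists N => m n Nm Nn; rewrite (lt_trans (vB m n))// [e]splitr.
  by rewrite ltrD// sN.
pose w := CauchySequence Cv; apply/cvg_ex; exists (\pi_completion w).
apply/cvgrPdist_le => e e0.
have e3 : 0 < e / 3 by rewrite divr_gt0.
have [N sN] := small _ e3.
apply: filterS (Fv N) => y; rewrite -ball_normE/= => Ny.
rewrite -(subrKA (completion_embed (v N))) (le_trans (ler_normD _ _))//.
have -> : e = (e / 3 + e / 3) + e / 3 by lra.
rewrite lerD//; last by rewrite (le_trans (ltW Ny))// ltW// sN.
rewrite -completion_piB; apply: (@completion_norm_le _ _ N) => n Nn.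
rewrite cauchy_sequenceBE/= (le_trans (ltW (vB n N)))//.
by rewrite lerD// ltW// sN.
Qed.

HB.instance Definition _ :=
  Uniform_isComplete.Build completion completion_complete.

End Completion.

Definition tree := {p : nat * nat | (1 <= p.2 <= 2 ^ p.1)%N}.

Definition immediate_succ (p q : tree) : bool :=
  ((val q).1 == (val p).1.+1) &&
  (((val q).2 == ((val p).2.*2).-1) || ((val q).2 == (val p).2.*2)).

(** A list related by [immediate_succ] has no repetition (see [segment_uniq]),
    so summing over it is summing over the set of its nodes. The empty list is
    allowed; it contributes nothing to the norm. *)
Definition segment (S : seq tree) : bool := sorted immediate_succ S.

Definition disjoint_segments (F : seq (seq tree)) : bool :=
  all segment F && pairwise (fun S1 S2 : seq tree => ~~ has (mem S1) S2) F.

Section FinitelySupported.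
Variable R : realType.

Definition finsupp_pred : {pred tree -> R} :=
  fun x => `[< finite_set [set p | x p != 0] >].

Lemma finsupp_predP (x : tree -> R) :
  reflect (finite_set [set p | x p != 0]) (x \in finsupp_pred).
Proof. by apply: (iffP idP) => [/asboolP|?]; last apply/asboolP. Qed.

Fact finsupp_submod_closed : submod_closed finsupp_pred.
Proof.
split=> [|a x y /finsupp_predP fx /finsupp_predP fy]; apply/finsupp_predP.
  rewrite (_ : [set _ | _] = set0)//; apply/seteqP; split=> // p /=.
  by rewrite eqxx.
apply: (@sub_finite_set _ _ ([set p | x p != 0] `|` [set p | y p != 0])).
  move=> p /=; have [x0|] := eqVneq (x p) 0; last by left.
  have [y0|] := eqVneq (y p) 0; last by right.
  by rewrite -[(_ + _) p]/(a *: x p + y p) x0 y0 scaler0 addr0 eqxx.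
by rewrite finite_setU.
Qed.

HB.instance Definition _ := GRing.isSubmodClosed.Build R (tree -> R)
  finsupp_pred finsupp_submod_closed.

Record c00 := C00 { c00_val :> tree -> R ; _ : c00_val \in finsupp_pred }.

HB.instance Definition _ := [isSub for c00_val].
HB.instance Definition _ := [Choice of c00 by <:].
HB.instance Definition _ := [SubChoice_isSubLmodule of c00 by <:].

Implicit Types (x y : c00) (F : seq (seq tree)) (a : R).

Lemma c00_finite x : finite_set [set p | x p != 0].
Proof. by case: x => x /= /finsupp_predP. Qed.

Definition JTsum F x : R :=
  Num.sqrt (\sum_(S <- F) (\sum_(p <- S) x p) ^+ 2).

Definition JTnorm x : R :=
  sup [set JTsum F x | F in [set F | disjoint_segments F]].

Lemma sqrt_sum_sqrD (I : Type) (s : seq I) (f g : I -> R) :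
  Num.sqrt (\sum_(i <- s) (f i + g i) ^+ 2) <=
  Num.sqrt (\sum_(i <- s) f i ^+ 2) + Num.sqrt (\sum_(i <- s) g i ^+ 2).
Proof.
have sq0 (h : I -> R) t : 0 <= \sum_(i <- t) h i ^+ 2.
  by apply: sumr_ge0 => i _; exact: sqr_ge0.
elim: s => [|i s IH]; first by rewrite !big_nil sqrtr0 addr0.
rewrite !big_cons.
set A := \sum_(j <- s) _ in IH *; set B := \sum_(j <- s) _ in IH *.
set C := \sum_(j <- s) _ in IH *.
have A0 : 0 <= A by exact: sq0.
have B0 : 0 <= B by exact: sq0.
have C0 : 0 <= C by exact: sq0.
set b := Num.sqrt B in IH; set c := Num.sqrt C in IH.
have b0 : 0 <= b by exact: sqrtr_ge0.
have c0 : 0 <= c by exact: sqrtr_ge0.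
have Bb : B = b ^+ 2 by rewrite sqr_sqrtr.
have Cc : C = c ^+ 2 by rewrite sqr_sqrtr.
have Ale : A <= (b + c) ^+ 2.
  by rewrite -(sqr_sqrtr A0) lerXn2r// ?nnegrE ?sqrtr_ge0// addr_ge0.
set u := f i; set v := g i; rewrite Bb Cc.
set X := Num.sqrt (u ^+ 2 + _); set Y := Num.sqrt (v ^+ 2 + _).
have X0 : 0 <= X by exact: sqrtr_ge0.
have Y0 : 0 <= Y by exact: sqrtr_ge0.
have X2 : X ^+ 2 = u ^+ 2 + b ^+ 2 by rewrite sqr_sqrtr// addr_ge0 ?sqr_ge0.
have Y2 : Y ^+ 2 = v ^+ 2 + c ^+ 2 by rewrite sqr_sqrtr// addr_ge0 ?sqr_ge0.
rewrite -[leRHS]ger0_norm ?addr_ge0// -sqrtr_sqr ler_wsqrtr//.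
have XY : u * v + b * c <= X * Y.
  rewrite (le_trans (ler_norm _))// -sqrtr_sqr.
  rewrite -[leRHS]ger0_norm ?mulr_ge0// -sqrtr_sqr ler_wsqrtr// exprMn X2 Y2.
  have := sqr_ge0 (u * c - v * b); nra.
by nra.
Qed.

Lemma JTsumD F x y : JTsum F (x + y) <= JTsum F x + JTsum F y.
Proof.
rewrite /JTsum (eq_bigr (fun S => (\sum_(p <- S) x p + \sum_(p <- S) y p) ^+ 2)).
  exact: sqrt_sum_sqrD.
by move=> S _; rewrite -big_split.
Qed.

Lemma JTsumZ F a x : JTsum F (a *: x) = `|a| * JTsum F x.
Proof.
rewrite /JTsum (eq_bigr (fun S => a ^+ 2 * (\sum_(p <- S) x p) ^+ 2)).
  by rewrite -mulr_sumr sqrtrM ?sqr_ge0// sqrtr_sqr.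
by move=> S _; rewrite -exprMn mulr_sumr.
Qed.

Lemma segment_uniq S : segment S -> uniq S.
Proof.
move=> sS; pose lev (p : tree) := (val p).1.
apply: (@map_uniq _ _ lev); apply: (sorted_uniq ltn_trans ltnn).
rewrite sorted_map; apply: sub_sorted sS => p q.
by rewrite /immediate_succ /relpre/= => /andP[/eqP qp _]; rewrite /lev qp.
Qed.

Lemma disjoint_segments_uniq F : disjoint_segments F -> uniq (flatten F).
Proof.
elim: F => //= S F IH /andP[/= /andP[sS sF] /andP[dS dF]].
rewrite cat_uniq segment_uniq// IH /disjoint_segments ?sF ?dF//= andbT.
apply/hasPn => p /flattenP[S' S'F pS']; apply/negP => pS.
move/allP/(_ _ S'F)/hasPn/(_ _ pS') : dS.
by rewrite /= pS.
Qed.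

Lemma sum_sqr_le_sqr_sum (I : Type) (s : seq I) (f : I -> R) :
  (forall i, 0 <= f i) -> \sum_(i <- s) f i ^+ 2 <= (\sum_(i <- s) f i) ^+ 2.
Proof.
move=> f0; elim: s => [|i s IH]; first by rewrite !big_nil expr0n.
rewrite !big_cons; have s0 : 0 <= \sum_(i <- s) f i by exact: sumr_ge0.
by have := f0 i; nra.
Qed.

Lemma JTsum_bounded x : has_ubound [set JTsum F x | F in disjoint_segments].
Proof.
have [s [us sE]] : exists s : seq tree,
    uniq s /\ forall p, x p != 0 -> p \in s.
  have /finite_seqP[s sE] := c00_finite x.
  exists (undup s); split; first exact: undup_uniq.
  by move=> p xp; rewrite mem_undup; have : [set` s] p by rewrite -sE.
exists (\sum_(p <- s) `|x p|) => _ [F dF <-].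
have M0 : 0 <= \sum_(p <- s) `|x p| by exact: sumr_ge0.
rewrite -[leRHS]ger0_norm// -sqrtr_sqr ler_wsqrtr//.
apply: (@le_trans _ _ ((\sum_(S <- F) \sum_(p <- S) `|x p|) ^+ 2)).
  rewrite (le_trans _ (sum_sqr_le_sqr_sum _ _))//; last first.
    by move=> S; exact: sumr_ge0.
  apply: ler_sum => S _; rewrite -[leLHS]real_normK ?num_real//.
  by rewrite lerXn2r ?nnegrE// ?ler_norm_sum// sumr_ge0.
rewrite -big_flatten/= lerXn2r ?nnegrE ?sumr_ge0//.
rewrite (bigID (fun p => p \in s))/= [X in _ + X]big1 ?addr0; last first.
  by move=> p; apply: contraNeq; rewrite normr_eq0 => /sE.
rewrite -big_filter.
set t := [seq p <- flatten F | p \in s].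
rewrite [leRHS](bigID (fun p => p \in t))/= -[X in _ <= X + _]big_filter.
rewrite [leLHS](perm_big [seq p <- s | p \in t])/=.
  by rewrite lerDl sumr_ge0.
apply: uniq_perm; rewrite ?filter_uniq ?disjoint_segments_uniq//.
by move=> p; rewrite !mem_filter/= -andbA; case: (p \in s); rewrite /= ?andbF ?andbT//= andbT.
Qed.

Lemma JTsum_has_sup x : has_sup [set JTsum F x | F in disjoint_segments].
Proof.
by split; [exists (JTsum [::] x), [::]|exact: JTsum_bounded].
Qed.

Lemma JTsum_le F x : disjoint_segments F -> JTsum F x <= JTnorm x.
Proof.
by move=> dF; apply: (sup_upper_bound (JTsum_has_sup x)); exists F.
Qed.

Lemma JTnorm_le x e : (forall F, disjoint_segments F -> JTsum F x <= e) ->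
  JTnorm x <= e.
Proof.
move=> xe; apply: ge_sup; first by have [] := JTsum_has_sup x.
by move=> _ [F dF <-]; exact: xe.
Qed.

Fact JTnorm_ge0 x : 0 <= JTnorm x.
Proof. by apply: le_trans (@JTsum_le [::] x isT); exact: sqrtr_ge0. Qed.

Fact JTnormD x y : JTnorm (x + y) <= JTnorm x + JTnorm y.
Proof.
apply: JTnorm_le => F dF; rewrite (le_trans (JTsumD _ _ _))//.
by rewrite lerD// JTsum_le.
Qed.

Fact JTnormZ a x : JTnorm (a *: x) = `|a| * JTnorm x.
Proof.
have le b y : JTnorm (b *: y) <= `|b| * JTnorm y.
  by apply: JTnorm_le => F dF; rewrite JTsumZ ler_wpM2l// JTsum_le.
apply/eqP; rewrite eq_le le/=.
have [->|a0] := eqVneq a 0; first by rewrite normr0 mul0r JTnorm_ge0.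
rewrite -ler_pdivlMl ?normr_gt0//.
by rewrite -{1}(scalerK a0 x) (le_trans (le _ _))// normfV.
Qed.

Fact JTnorm0_eq0 x : JTnorm x = 0 -> x = 0.
Proof.
move=> x0; apply/val_inj/funext => p /=.
have : JTsum [:: [:: p]] x <= 0 by rewrite -x0; exact: JTsum_le.
rewrite /JTsum !big_cons !big_nil !addr0 sqrtr_sqr normr_le0.
by move/eqP.
Qed.

HB.instance Definition _ :=
  Lmodule_isNormed.Build R c00 JTnormD JTnormZ JTnorm0_eq0.

Lemma c00_normE x : `|x| = JTnorm x.
Proof. by []. Qed.

End FinitelySupported.

Definition JT (R : realType) : completeNormedModType R := completion (c00 R).

Section WeakLebesgueProperty.
Variable R : realType.

(** Tagged partitions of [0, 1], listed in increasing order;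
    only the values [point 0 .. point size] and [tag 0 .. tag (size - 1)]
    are relevant. *)
Record tagged_partition := TaggedPartition {
  tp_size : nat ;
  tp_point : nat -> R ;
  tp_tag : nat -> R ;
  tp_point0 : tp_point 0%N = 0 ;
  tp_point1 : tp_point tp_size = 1 ;
  tp_tagP : forall i, (i < tp_size)%N ->
    tp_point i < tp_tag i < tp_point i.+1 }.

Definition mesh (P : tagged_partition) : R :=
  \big[Num.max/0]_(i < tp_size P) (tp_point P i.+1 - tp_point P i).

Variable X : completeNormedModType R.

(** Functions on [0, 1] are represented by functions on R, whose values
    outside [0, 1] are irrelevant. *)
Implicit Types f : R -> X.

Definition riemann_sum f (P : tagged_partition) : X :=
  \sum_(i < tp_size P) (tp_point P i.+1 - tp_point P i) *: f (tp_tag P i).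

Definition has_riemann_integral f (x : X) :=
  forall e : R, 0 < e -> exists2 d : R, 0 < d &
    forall P : tagged_partition, mesh P < d -> `|riemann_sum f P - x| < e.

Definition riemann_integrable f := exists x : X, has_riemann_integral f x.

Definition topological_dual : Type :=
  {phi : {scalar X} | continuous (phi : X -> R)}.

(** X with its weak topology: the coarsest one making every element of the
    topological dual continuous *)
Definition weak_space : topologicalType :=
  sup_topology (fun phi : topological_dual =>
    Topological.class (initial_topology (sval phi : X -> R))).

Definition weakly_continuous_at f (t : R) :=
  f s @[s --> within `[0, 1] (nbhs t)] --> (f t : weak_space).

Definition weak_lebesgue_property :=
  forall f, riemann_integrable f ->
    (@lebesgue_measure R).-negligible
      [set t | t \in `[0, 1] /\ ~ weakly_continuous_at f t].

End WeakLebesgueProperty.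

(* Main.v *)
Require Import Defs.
From HB Require Import structures.
From mathcomp Require Import all_boot all_order all_algebra.
From mathcomp Require Import all_classical all_reals all_analysis.
From mathcomp Require Import lra.

(** Let [f] send the midpoint [t_p = (2k - 1) / 2 ^ (n + 1)] of the dyadic
    interval of each node [p = (n, k)] to the unit vector [e_p], and all other
    points to [0].

    In a Riemann sum of mesh at most [d], the coefficients of the nodes whose
    midpoints lie in [[a, b]] add up to at most [b - a + 2 d]. Hence every
    segment of the tree carries at most [eta = 2 d (m + 1) + 2 ^- m], for any
    [m]: its first [m] nodes carry at most [2 d] each, and the remaining ones
    have midpoints in a dyadic interval of length at most [2 ^- m]. Since
    disjoint segments carry at most [1 + 2 d] altogether, the squared norm of
    the Riemann sum is at most [eta (1 + 2 d)], so [f] has integral [0].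

    If [t] in [[0, 1[] is not a midpoint, the nodes whose dyadic intervals
    contain [t] form an infinite branch. Summation along this branch is a
    functional of norm at most [1] which is [1] at the [e_p] of the branch,
    whose midpoints tend to [t], while [f t = 0]. So [f] is weakly
    discontinuous outside a countable set. *)

Set Implicit Arguments.
Unset Strict Implicit.
Unset Printing Implicit Defensive.

Import Order.TTheory GRing.Theory Num.Theory.
Import numFieldNormedType.Exports.

Local Open Scope classical_set_scope.
Local Open Scope ring_scope.
Local Open Scope quotient_scope.

(** * Dyadic intervals of nodes, and mass bounds along segments *)

Section DyadicMidpoints.
Variable R : realType.
Implicit Types (p q : tree) (S : seq tree).

Definition level p : nat := (val p).1.
Definition lower p : R := ((val p).2%:R - 1) / 2 ^+ level p.
Definition upper p : R := (val p).2%:R / 2 ^+ level p.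
Definition midpoint p : R := ((val p).2%:R *+ 2 - 1) / 2 ^+ (level p).+1.

Lemma node_gt0 p : (0 < (val p).2)%N.
Proof. by case: p => p /= => /andP[]. Qed.

Lemma node_le p : ((val p).2 <= 2 ^ level p)%N.
Proof. by case: p => p; rewrite /level /= => /andP[]. Qed.

Lemma lower_ge0 p : 0 <= lower p.
Proof. by rewrite divr_ge0 ?exprn_ge0// subr_ge0 ler1n node_gt0. Qed.

Lemma upper_le1 p : upper p <= 1.
Proof.
by rewrite /upper ler_pdivrMr ?exprn_gt0// mul1r -natrX ler_nat node_le.
Qed.

Lemma upperBlower p : upper p - lower p = (2 ^+ level p)^-1.
Proof. by rewrite /upper /lower -mulrBl opprB addrCA subrr addr0 mul1r. Qed.

Lemma midpoint_itv p : lower p <= midpoint p <= upper p.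
Proof.
have e0 : 0 < (2 ^+ level p)^-1 :> R by rewrite invr_gt0 exprn_gt0.
rewrite /lower /upper /midpoint exprS invfM mulrA !ler_pM2r//.
by rewrite mulr2n; apply/andP; split; lra.
Qed.

Lemma midpoint01 p : 0 <= midpoint p <= 1.
Proof.
have /andP[lm mu] := midpoint_itv p.
by rewrite (le_trans (lower_ge0 p) lm) (le_trans mu (upper_le1 p)).
Qed.

Lemma midpoint_inj : injective midpoint.
Proof.
have mE p : midpoint p = ((val p).2.*2.-1)%:R / 2 ^+ (level p).+1.
  have := node_gt0 p; rewrite /midpoint; case: (val p).2 => // k _.
  rewrite doubleS -!muln2/= -!natr1 natrM; congr (_ / _).
  by rewrite mulr2n; lra.
(* If [level p < level q], clearing denominators and cancelling powers of two equates an even number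
   with the odd numerator of [midpoint q]. *)
have odd_lt p q : midpoint p = midpoint q -> (level q <= level p)%N.
  move=> pq; rewrite leqNgt; apply/negP => lt_pq; move: pq; rewrite !mE => /eqP.
  rewrite eqr_div ?expf_neq0 ?pnatr_eq0// -!natrX -!natrM eqr_nat.
  rewrite -(subnK lt_pq) -addSn expnD mulnA eqn_pmul2r ?expn_gt0// => /eqP.
  move/(congr1 odd).
  have := node_gt0 p; case: (val p).2 => // a _.
  have := node_gt0 q; case: (val q).2 => // b _.
  by rewrite oddM oddX !doubleS/= !odd_double.
move=> p q pq; have lpq : level p = level q.
  by apply/eqP; rewrite eqn_leq !odd_lt.
move: pq; rewrite /midpoint lpq => /(divIf _)H.
have {H} : (val p).2%:R *+ 2 - 1 = (val q).2%:R *+ 2 - 1 :> R.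
  by apply: H; rewrite expf_neq0.
move/addIr/eqP; rewrite eqr_pMn2r// eqr_nat => /eqP kpq.
apply/val_inj; move: lpq kpq; rewrite /level.
by case: (val p) (val q) => [? ?] [? ?] /= -> ->.
Qed.

Lemma immediate_succ_level p q : immediate_succ p q -> level q = (level p).+1.
Proof. by move=> /andP[/eqP]. Qed.

Lemma immediate_succ_itv p q : immediate_succ p q ->
  lower p <= lower q /\ upper q <= upper p.
Proof.
move=> pq; rewrite /lower /upper (immediate_succ_level pq) exprS invfM !mulrA.
have e0 : 0 < (2 ^+ level p)^-1 :> R by rewrite invr_gt0 exprn_gt0.
rewrite !ler_pM2r//; case/andP: pq => _; have := node_gt0 p.
case: (val p).2 => // k _.
have kE : k.+1%:R = k%:R + 1 :> R by rewrite natr1.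
have k2E : k.*2.+1%:R = k%:R * 2 + 1 :> R by rewrite -natr1 -muln2 natrM.
have k22E : k.*2.+2%:R = k%:R * 2 + 2 :> R by rewrite -addn2 natrD -muln2 natrM.
rewrite doubleS/= => /orP[] /eqP ->; rewrite kE ?k2E ?k22E.
  by split; lra.
by split; lra.
Qed.

Lemma segment_itv p S q : segment (p :: S) -> q \in p :: S ->
  lower p <= lower q /\ upper q <= upper p.
Proof.
elim: S p => [|r S IH] p /=; first by move=> _; rewrite inE => /eqP ->.
move=> /andP[/immediate_succ_itv[pr rp] rS]; rewrite inE => /orP[/eqP ->//|].
by move=> /(IH _ rS)[rq qr]; split; lra.
Qed.

Section SegmentSum.
Variables (x : tree -> R) (d : R).
Hypothesis x_ge0 : forall p, 0 <= x p.
(** The coefficients of a Riemann sum satisfy this with [d] equal to twice a bound on the mesh. *)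
Hypothesis sum_window : forall S a b, uniq S -> a <= b ->
  (forall p, p \in S -> a <= midpoint p <= b) ->
  \sum_(p <- S) x p <= b - a + d.

Lemma node_le_window p : x p <= d.
Proof.
have /(_ (midpoint p) (midpoint p)) := @sum_window [:: p].
rewrite subrr add0r big_seq1; apply => // q.
by rewrite inE => /eqP ->; rewrite lexx.
Qed.

Lemma window_ge0 : 0 <= d.
Proof.
by have := @sum_window [::] 0 0 isT (lexx _); rewrite subrr add0r big_nil; apply.
Qed.

(** Induction on [m]: the head costs [d] by a one-point window, and its successor is one level
    deeper, which preserves [level p + m]. At [m = 0] all midpoints lie between [lower p] and
    [upper p]. *)
Lemma segment_sum_le m p S : segment (p :: S) ->
  \sum_(q <- p :: S) x q <= d *+ m + (2 ^+ (level p + m))^-1 + d.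
Proof.
elim: m p S => [|m IH] p S pS.
  rewrite mulr0n add0r addn0 -upperBlower; apply: sum_window.
  - exact: segment_uniq.
  - by have /andP[/le_trans] := midpoint_itv p; apply.
  - move=> q /(segment_itv pS)[pq qp]; have /andP[? ?] := midpoint_itv q.
    by apply/andP; split; lra.
rewrite big_cons (mulrS d) -2!addrA lerD ?node_le_window//.
case: S pS => [_|q S /= /andP[/immediate_succ_level pq qS]].
  by rewrite big_nil !addr_ge0 ?mulrn_wge0 ?window_ge0// invr_ge0 exprn_ge0.
by rewrite addnS -addSn -pq addrA IH.
Qed.

Lemma JTsum_window_le m F : disjoint_segments F ->
  \sum_(S <- F) (\sum_(p <- S) x p) ^+ 2 <=
  (d *+ m.+1 + (2 ^+ m)^-1) * (1 + d).
Proof.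
move=> dF; set e := d *+ m.+1 + _.
have e0 : 0 <= e.
  by rewrite addr_ge0 ?mulrn_wge0 ?window_ge0// invr_ge0 exprn_ge0.
have Se S : segment S -> \sum_(p <- S) x p <= e.
  case: S => [_|p S pS]; first by rewrite big_nil.
  apply: (le_trans (segment_sum_le m pS)).
  (* The final [d], from the window of the tail, accounts for [m.+1] in [e]. *)
  rewrite /e (mulrSr d) [leRHS]addrAC lerD2r lerD2l lef_pV2 ?posrE ?exprn_gt0//.
  by rewrite ler_eXn2l ?leq_addl// ltr1n.
(* One factor of each square is bounded by [e]; the other factors add up to at most the mass of the
   window [[0, 1]]. *)
apply: (@le_trans _ _ (\sum_(S <- F) e * \sum_(p <- S) x p)).
  case/andP: dF => /allP sF _; rewrite !big_seq; apply: ler_sum => S SF.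
  by rewrite expr2 ler_wpM2r ?sumr_ge0// Se// sF.
rewrite -mulr_sumr -big_flatten ler_wpM2l//.
have := @sum_window (flatten F) 0 1; rewrite subr0; apply => //.
  exact: disjoint_segments_uniq.
by move=> p _; exact: midpoint01.
Qed.

End SegmentSum.

Lemma window_sum_le (P : tagged_partition R) (d a b : R) :
  mesh P <= d -> a <= b ->
  \sum_(i < tp_size P) (tp_point P i.+1 - tp_point P i) *
    (a <= tp_tag P i <= b)%R%:R <= b - a + d *+ 2.
Proof.
move=> Pd ab; have d0 : 0 <= d.
  by apply: le_trans Pd; apply: bigmax_ge_id.
(* Clamping to [[a - d, b + d]] keeps the length of every cell with tag in [[a, b]] and makes no
   length negative, so the telescoping sum of clamped lengths bounds the mass. *)
pose c (x : R) := Num.max (a - d) (Num.min x (b + d)).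
have cE x : a - d <= x <= b + d -> c x = x.
  by move=> /andP[ax xb]; rewrite /c min_l// max_r.
have c_le x y : x <= y -> c x <= c y.
  by move=> xy; apply: le_max2 => //; exact: le_min2.
have cb x : a - d <= c x <= b + d.
  rewrite /c le_max lexx/= ge_max ge_min lexx orbT andbT; lra.
apply: (@le_trans _ _ (\sum_(i < tp_size P)
    (c (tp_point P i.+1) - c (tp_point P i)))).
  apply: ler_sum => i _; have /andP[ps sp] := tp_tagP (ltn_ord i).
  have [/andP[as_ sb]|_] := boolP (_ && _); last first.
    by rewrite mulr0 subr_ge0 c_le//; lra.
  have := le_trans (le_bigmax 0 (fun i : 'I__ => _) i) Pd.
  move=> /= Dd; rewrite mulr1 !cE//; apply/andP; split; lra.
rewrite -(big_mkord predT (fun i => c (tp_point P i.+1) - c (tp_point P i))).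
rewrite telescope_sumr//.
have /andP[? ?] := cb (tp_point P 0).
have /andP[? ?] := cb (tp_point P (tp_size P)).
by rewrite mulr2n; lra.
Qed.

End DyadicMidpoints.

(** * Extension of bounded functionals to the completion *)

Section FunctionalExtension.
Variables (R : realType) (V : normedModType R) (phi : {scalar V}) (C : R).
Hypothesis phi_le : forall v, `|phi v| <= C * `|v|.

Definition completion_extension (x : completion V) : R :=
  lim (phi (repr x n) @[n --> \oo]).

(** The bound on [phi] makes images of Cauchy sequences Cauchy and images of null sequences null, so
    the limit does not depend on the representative. *)
Lemma completion_extension_cvg (u : cauchy_sequence V) :
  phi (u n) @[n --> \oo] --> completion_extension (\pi_(completion V) u).
Proof.
have C0 : 0 < `|C| + 1 by rewrite ltr_pwDr.
have phi_lt v e : `|v| < e / (`|C| + 1) -> `|phi v| < e.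
  rewrite ltr_pdivlMr// mulrC; apply: le_lt_trans.
  rewrite (le_trans (phi_le v))// ler_wpM2r//.
  by rewrite (le_trans (ler_norm C))// lerDl.
set w : cauchy_sequence V := repr (\pi_(completion V) u).
have wl : phi (w n) @[n --> \oo] --> completion_extension (\pi_(completion V) u).
  apply/cauchy_cvgP/cauchyP => e e0.
  have [N wN] := cauchy_sequenceP w (divr_gt0 e0 C0).
  exists (phi (w N)), N => // n /= Nn; rewrite -ball_normE/= -raddfB.
  exact/phi_lt/wN.
have /null_seqP uw0 : w - u \in @null_seq_pred R V.
  by apply/completion_piP; rewrite reprK.
apply/cvgrPdist_lt => e e0; have e2 : 0 < e / 2 by rewrite divr_gt0.
move/cvgrPdist_lt/(_ _ e2) : wl => wl.
move/cvgrPdist_lt/(_ _ (divr_gt0 e2 C0)) : uw0 => uw0.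
apply: filterS2 wl uw0 => n wn un; rewrite -(subrKA (phi (w n))) [e]splitr.
rewrite (le_lt_trans (ler_normD _ _))// ltrD// -raddfB; apply: phi_lt.
by move: un; rewrite sub0r normrN.
Qed.

Lemma completion_extension_linear : linear_for *%R completion_extension.
Proof.
move=> a; elim/completion_ind => u; elim/completion_ind => v.
have -> : a *: \pi_(completion V) u + \pi_(completion V) v
    = \pi_(completion V) (a *: u + v).
  by rewrite completion_piD; congr (_ + _); exact: completion_scale_pi.
apply: (cvg_unique _ (@completion_extension_cvg (a *: u + v))) => //.
rewrite (_ : (fun n => _) = fun n => a * phi (u n) + phi (v n)); last first.
  by apply/funext => n; rewrite -linearP.
apply: cvgD (completion_extension_cvg (u := v)).
by apply: cvgMl_tmp; exact: completion_extension_cvg.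
Qed.

Lemma completion_extension_embed v :
  completion_extension (completion_embed v) = phi v.
Proof.
apply: (cvg_unique _
  (@completion_extension_cvg (CauchySequence (cst_cauchy v)))) => //=.
exact: cvg_cst.
Qed.

Lemma completion_extension_le x : `|completion_extension x| <= C * `|x|.
Proof.
elim/completion_ind: x => u.
apply: (ler_cvg_to (cvg_norm (completion_extension_cvg (u := u)))
  (cvgMl_tmp (a := C) (completion_normE (u := u)))).
by apply: nearW => n; exact: phi_le.
Qed.

Lemma completion_functional :
  exists2 psi : {scalar completion V}, continuous (psi : completion V -> R) &
    forall v, psi (completion_embed v) = phi v.
Proof.
pose m := GRing.isLinear.Build R (completion V) R *%R _
  completion_extension_linear.
pose psi : {scalar completion V} := HB.pack completion_extension m.
exists psi; last exact: completion_extension_embed.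
apply: (@bounded_linear_continuous _ _ R^o psi).
apply/linear_boundedP.
exists C; split; first exact: num_real.
move=> y Cy x; rewrite (le_trans (completion_extension_le x))//.
by rewrite ler_wpM2r// ltW.
Qed.

End FunctionalExtension.

(** * Infinite branches and summation along them *)

Section Branches.
Variable R : realType.

Section BranchFunctional.
Variable b : nat -> tree.
Hypothesis b_succ : forall n, immediate_succ (b n) (b n.+1).

Lemma branch_level n : level (b n) = (level (b 0) + n)%N.
Proof.
elim: n => [|n IH]; first by rewrite addn0.
by rewrite (immediate_succ_level (b_succ n)) IH addnS.
Qed.

Lemma branch_inj : injective b.
Proof.
move=> m n /(congr1 level).
by rewrite (branch_level m) (branch_level n) => /addnI.
Qed.

Lemma branch_eventually0 (x : c00 R) :
  exists N, forall n, (N <= n)%N -> x (b n) = 0.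
Proof.
have /finite_seqP[s sE] := c00_finite x.
(* Since [b n] has level at least [n], it lies below every node of the support. *)
exists (\max_(p <- s) level p).+1 => n; rewrite ltnNge => nN.
apply/eqP/negP => /negP xbn.
have bs : b n \in s by have : [set` s] (b n) by rewrite -sE.
move/negP : nN; apply; rewrite (@leq_trans (level (b n)))//.
  by rewrite branch_level leq_addl.
exact: (leq_bigmax_seq _ bs).
Qed.

(** The sum along the whole branch, cut at some index past the support; [branch_sumE] shows that any
    such cutoff will do. *)
Definition branch_sum (x : c00 R) : R :=
  \sum_(k < projT1 (cid (branch_eventually0 x))) x (b k).

Lemma branch_sumE (x : c00 R) N : (forall n, (N <= n)%N -> x (b n) = 0) ->
  branch_sum x = \sum_(k < N) x (b k).
Proof.
have le M1 M2 : (M1 <= M2)%N -> (forall n, (M1 <= n)%N -> x (b n) = 0) ->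
    \sum_(k < M1) x (b k) = \sum_(k < M2) x (b k).
  move=> M12 x0; rewrite (big_ord_widen M2 (fun k => x (b k)))// big_mkcond/=.
  by apply: eq_bigr => k _; case: ltnP => // /x0.
rewrite /branch_sum; case: cid => M /= xM xN.
by have [/le|/ltnW/le] := leqP M N; [apply|move=> ->].
Qed.

Lemma branch_sum_linear : linear_for *%R branch_sum.
Proof.
move=> a x y; have [M xM] := branch_eventually0 x.
have [N yN] := branch_eventually0 y.
have xMN n : (maxn M N <= n)%N -> x (b n) = 0.
  by rewrite geq_max => /andP[/xM].
have yMN n : (maxn M N <= n)%N -> y (b n) = 0.
  by rewrite geq_max => /andP[_ /yN].
rewrite (branch_sumE xMN) (branch_sumE yMN) (@branch_sumE _ (maxn M N)).
  by rewrite mulr_sumr -big_split.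
move=> n Mn; rewrite -[LHS]/(a * x (b n) + y (b n)).
by rewrite xMN// yMN// mulr0 addr0.
Qed.

(** An initial stretch of the branch is a single segment, hence an admissible family for the
    norm. *)
Lemma branch_sum_le (x : c00 R) : `|branch_sum x| <= `|x|.
Proof.
have [N xN] := branch_eventually0 x; rewrite (branch_sumE xN).
have bN : disjoint_segments [:: mkseq b N].
  rewrite /disjoint_segments/= !andbT /segment.
  case: N {xN} => // N; apply/(sortedP (b 0)) => i; rewrite size_mkseq => iN.
  by rewrite !nth_mkseq// ltnW.
apply: le_trans (JTsum_le x bN).
by rewrite /JTsum big_seq1 sqrtr_sqr big_map -[X in iota 0 X]subn0
  -/(index_iota 0 N) big_mkord.
Qed.

End BranchFunctional.

Lemma dyadic_branch (t : R) : 0 <= t < 1 -> exists b : nat -> tree,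
  [/\ forall n, level (b n) = n, forall n, immediate_succ (b n) (b n.+1) &
    forall n, lower R (b n) <= t <= upper R (b n)].
Proof.
move=> /andP[t0 t1].
(* The integer part of [t * 2 ^+ n]; nodes are numbered from 1, whence [(k n).+1] below, and [t < 1]
   keeps it at most [2 ^ n]. *)
pose k n := Num.truncn (t * 2 ^+ n).
have tn n : 0 <= t * 2 ^+ n by rewrite mulr_ge0// exprn_ge0.
have kP n : (1 <= (n, (k n).+1).2 <= 2 ^ (n, (k n).+1).1)%N.
  rewrite /= truncn_lt_nat// natrX.
  by rewrite -[ltRHS]mul1r ltr_pM2r// exprn_gt0.
pose b n : tree := exist _ (n, (k n).+1) (kP n).
exists b; split => // n.
  rewrite /immediate_succ/= eqxx/= doubleS/= !eqSS.
  have /andP[kl ku] := truncn_itv (tn n).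
  (* Doubling a real doubles its integer part or doubles it and adds 1: these are the two
     successors. *)
  have kE : k n.+1 = (k n).*2 \/ k n.+1 = (k n).*2.+1.
    have k2 : (k n).*2%:R = (k n)%:R * 2 :> R by rewrite -muln2 natrM.
    have k21 : (k n).*2.+1%:R = (k n)%:R * 2 + 1 :> R by rewrite -natr1 k2.
    have k22 : (k n).*2.+2%:R = (k n)%:R * 2 + 2 :> R
      by rewrite -addn2 natrD k2.
    have tE : t * 2 ^+ n.+1 = t * 2 ^+ n * 2 by rewrite exprSr mulrA.
    move: kl ku; rewrite -/(k n) -natr1 => kl ku.
    have [lt|ge] := ltP (t * 2 ^+ n * 2) ((k n)%:R * 2 + 1).
      by left; apply: truncn_def; rewrite tE k21 k2; apply/andP; split; lra.
    by right; apply: truncn_def; rewrite tE k22 k21; apply/andP; split; lra.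
  by case: kE => ->; rewrite eqxx ?orbT.
have /andP[kl ku] := truncn_itv (tn n).
rewrite /lower /upper/= ler_pdivrMr ?exprn_gt0// ler_pdivlMr ?exprn_gt0//.
by rewrite -[X in X - 1]natr1 addrK kl ltW.
Qed.

End Branches.

(** * The function, its integral and its weak discontinuities *)

Section Counterexample.
Variable R : realType.
Implicit Types (t : R) (p : tree).

Fact midpoint_delta_finsupp t :
  (fun p => (t == midpoint R p)%:R : R) \in @finsupp_pred R.
Proof.
apply/finsupp_predP; have [[p tp]|tm] := pselect (exists p, t = midpoint R p).
  apply: (@sub_finite_set _ _ [set p]); last exact: finite_set1.
  move=> q /=; rewrite pnatr_eq0 eqb0 negbK tp => /eqP.
  by move/midpoint_inj.
rewrite (_ : [set _ | _] = set0)//; apply/seteqP; split=> // p /=.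
by rewrite pnatr_eq0 eqb0 negbK => /eqP tp; apply: tm; exists p.
Qed.

(** The unit vector of the node with midpoint [t], or [0] if there is none. *)
Definition midpoint_delta t : c00 R := C00 (midpoint_delta_finsupp t).

Definition midpoint_function t : JT R := completion_embed (midpoint_delta t).

Lemma midpoint_delta0 t : ~ range (midpoint R) t -> midpoint_delta t = 0.
Proof.
move=> tm; apply/val_inj/funext => p /=; case: eqP => // tp.
by case: tm; exists p.
Qed.

Lemma riemann_sum_embed (P : tagged_partition R) :
  riemann_sum midpoint_function P = completion_embed
    (\sum_(i < tp_size P) (tp_point P i.+1 - tp_point P i) *:
      midpoint_delta (tp_tag P i)).
Proof. by rewrite raddf_sum; apply: eq_bigr => i _; rewrite /= linearZ. Qed.

Lemma c00_sumE (I : Type) (s : seq I) (x : I -> c00 R) p :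
  (\sum_(i <- s) x i) p = \sum_(i <- s) x i p.
Proof.
elim: s => [|i s IH]; first by rewrite !big_nil.
by rewrite !big_cons -IH.
Qed.

Lemma riemann_sum_norm_le (P : tagged_partition R) (d : R) m : mesh P <= d ->
  `|riemann_sum midpoint_function P| ^+ 2 <=
  (d *+ 2 *+ m.+1 + (2 ^+ m)^-1) * (1 + d *+ 2).
Proof.
move=> Pd; rewrite riemann_sum_embed completion_embed_norm.
set x : c00 R := \sum_(i < _) _.
have xE p : x p = \sum_(i < tp_size P) (tp_point P i.+1 - tp_point P i) *
    (tp_tag P i == midpoint R p)%:R by rewrite c00_sumE.
have D0 (i : 'I_(tp_size P)) : 0 <= tp_point P i.+1 - tp_point P i.
  by have /andP[? ?] := tp_tagP (ltn_ord i); lra.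
have x0 p : 0 <= x p.
  by rewrite xE sumr_ge0// => i _; rewrite mulr_ge0.
have xW S a b : uniq S -> a <= b ->
    (forall p, p \in S -> a <= midpoint R p <= b) ->
    \sum_(p <- S) x p <= b - a + d *+ 2.
  move=> uS ab Sab; apply: le_trans (window_sum_le Pd ab).
  rewrite (eq_bigr _ (fun p _ => xE p)) exchange_big/=; apply: ler_sum => i _.
  rewrite -mulr_sumr ler_wpM2l//.
  (* By injectivity a tag is the midpoint of at most one node of [S], and if it is one then it lies
     in [[a, b]]. *)
  have [/hasP[p pS /eqP ip]|/hasPn iS] :=
      boolP (has (fun p => tp_tag P i == midpoint R p) S).
    rewrite (bigD1_seq p)//= big1 ?addr0; first by rewrite ip eqxx Sab.
    by move=> q; rewrite ip (inj_eq (@midpoint_inj R)) eq_sym => /negbTE ->.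
  by rewrite big_seq big1 ?ler0n// => p /iS /negbTE ->.
have dm F : disjoint_segments F -> JTsum F x <=
    Num.sqrt ((d *+ 2 *+ m.+1 + (2 ^+ m)^-1) * (1 + d *+ 2)).
  by move=> dF; rewrite ler_wsqrtr// JTsum_window_le.
have := JTnorm_le dm; rewrite -c00_normE => /(lerXn2r 2).
rewrite !nnegrE sqrtr_ge0 normr_ge0 => /(_ isT isT) /le_trans; apply.
(* The bound is nonnegative because it dominates the sum over the empty family. *)
rewrite sqr_sqrtr//.
by apply: le_trans (JTsum_window_le x0 xW m (F := [::]) isT); rewrite big_nil.
Qed.

Lemma midpoint_function_integrable : riemann_integrable midpoint_function.
Proof.
exists 0 => e e0.
have e20 : 0 < e ^+ 2 by rewrite exprn_gt0.
pose m := Num.truncn (4 / e ^+ 2).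
have m_lt : (2 ^+ m)^-1 < e ^+ 2 / 4 :> R.
  rewrite invf_plt ?posrE ?exprn_gt0 ?divr_gt0// invf_div.
  rewrite (lt_le_trans (truncnS_gt _))// -natrX ler_nat.
  by rewrite ltn_expl.
(* Then [1 + 2 d] is at most 2 and [2 d (m + 1)] at most [e ^+ 2 / 4]; with [m_lt] the product stays
   below [e ^+ 2]. *)
pose d := Num.min (1 / 2) (e ^+ 2 / 8 / m.+1%:R).
have d0 : 0 < d by rewrite lt_min !divr_gt0.
exists d => // P Pd; rewrite subr0 -(ltr_pXn2r (n := 2)) ?nnegrE// ?ltW//.
apply: le_lt_trans (riemann_sum_norm_le m (ltW Pd)) _.
have d12 : d <= 1 / 2 by rewrite ge_min lexx.
have dm : d * m.+1%:R <= e ^+ 2 / 8.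
  by rewrite -ler_pdivlMr// ge_min lexx orbT.
have -> : d *+ 2 *+ m.+1 = d * m.+1%:R * 2.
  by rewrite mulrnAC -(mulr_natr d) [RHS]mulr_natr.
apply: (@le_lt_trans _ _ ((d * m.+1%:R * 2 + (2 ^+ m)^-1) * 2)); last lra.
rewrite ler_wpM2l ?addr_ge0 ?mulr_ge0 ?invr_ge0 ?exprn_ge0 ?(ltW d0)//.
by rewrite -mulr_natr; lra.
Qed.

(** The weak topology is a supremum of initial topologies, one of which is that of [psi]. *)
Lemma weakly_continuous_functional (X : completeNormedModType R) (f : R -> X) t
    (psi : {scalar X}) : continuous (psi : X -> R) ->
  weakly_continuous_at f t ->
  psi (f s) @[s --> within `[0, 1] (nbhs t)] --> psi (f t).
Proof.
move=> cpsi /cvg_sup/(_ (exist _ psi cpsi)) ft.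
apply: cvg_comp ft _; exact: initial_continuous.
Qed.

Lemma midpoint_function_not_weakly_continuous t : 0 <= t < 1 ->
  ~ range (midpoint R) t -> ~ weakly_continuous_at midpoint_function t.
Proof.
move=> t01 tm; have [b [bn b_succ bt]] := dyadic_branch t01.
have b_le (x : c00 R) : `|branch_sum b_succ x| <= 1 * `|x|.
  by rewrite mul1r branch_sum_le.
pose l := GRing.isLinear.Build R (c00 R) R *%R _ (branch_sum_linear b_succ).
pose phi : {scalar c00 R} := HB.pack (branch_sum b_succ) l.
have [psi cpsi psiE] := @completion_functional R (c00 R) phi 1 b_le.
move=> /(weakly_continuous_functional cpsi).
rewrite {2}/midpoint_function midpoint_delta0// !raddf0.
move/cvgrPdist_lt/(_ _ ltr01).
rewrite near_withinE => /nbhs_ballP[e /= e0 te].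
(* Both [t] and the midpoint of [b n] lie in the dyadic interval of [b n], whose length [2 ^- n] is
   below [e]. *)
pose n := Num.truncn e^-1.
have n_lt : (2 ^+ n)^-1 < e.
  rewrite invf_plt ?posrE ?exprn_gt0//.
  by rewrite (lt_le_trans (truncnS_gt _))// -natrX ler_nat ltn_expl.
have := te (midpoint R (b n)); rewrite -ball_normE/=.
have -> : psi (midpoint_function (midpoint R (b n))) = 1.
  rewrite psiE /= (@branch_sumE _ _ _ _ n.+1) => [|k nk]/=.
    rewrite big_ord_recr/= eqxx big1 ?add0r// => k _.
    rewrite (inj_eq (@midpoint_inj R)) (inj_eq (branch_inj b_succ)).
    by rewrite gtn_eqF.
  rewrite (inj_eq (@midpoint_inj R)) (inj_eq (branch_inj b_succ)).
  by rewrite ltn_eqF.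
rewrite sub0r normrN normr1 ltxx => H; apply/notF/H.
  apply: le_lt_trans n_lt; rewrite -[in leRHS](bn n) -upperBlower.
  have /andP[? ?] := bt n; have /andP[? ?] := midpoint_itv R (b n).
  by rewrite ler_norml; apply/andP; split; lra.
by rewrite /= in_itv/= midpoint01.
Qed.

Lemma countable_midpoint : countable (range (midpoint R)).
Proof. exact: (sub_countable (card_image_le _ _) (countableP _)). Qed.

End Counterexample.

Theorem theorem2p3 (R : realType) : ~ weak_lebesgue_property (JT R).
Proof.
move=> /(_ _ (@midpoint_function_integrable R)) N.
have M : (@lebesgue_measure R).-negligible (range (midpoint R)).
  apply/negligibleP; last exact/countable_lebesgue_measure0/countable_midpoint.
  exact/countable_measurable/countable_midpoint.
(* The endpoint 1 is left out because the branch through [t] was built for [t < 1]; the interval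
   still has measure 1, a contradiction. *)
have : (@lebesgue_measure R).-negligible `[0, 1[.
  apply: negligibleS (negligibleU N M) => t /=; rewrite in_itv/= => t01.
  have [tM|tM] := pselect (range (midpoint R) t); [by right|left; split].
    by rewrite in_itv/=; move: t01 => /andP[-> /ltW ->].
  exact: midpoint_function_not_weakly_continuous.
move/negligibleP => /(_ (measurable_itv _)); rewrite /= lebesgue_measure_itv/=.
rewrite lte_fin ltr01 oppr0 adde0 => /eqP.
by rewrite onee_eq0.
Qed.
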